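(* For every fixed integer $d\ge 1$, the dimension $C(N,d)=\dim W_{\mathbf{I}(N)}$ of the level-$N$ sparse Haar approximation space on $[0,1]^d$ has, as a function of $N\in\mathbb{N}$, the leading order term $$C(N,d)\;\doteq\;\frac{N^{d-1}\,2^{N-d+1}}{(d-1)!},$$ i.e. $$\lim_{N\to\infty}\frac{C(N,d)\,(d-1)!}{N^{d-1}\,2^{N-d+1}}=1 .$$
   Context: Let $f_{\mathrm{Haar}}(x)=-\operatorname{sign}(x)$ if $|x|\le 1$ and $f_{\mathrm{Haar}}(x)=0$ otherwise. The one-dimensional Haar functions on $[0,1]$ are $f_{0,0}(x)=1$ (level $i=0$, with the single index $j=0$) and, for levels $i\ge 1$ and $j\in\{0,\ldots,2^{i-1}-1\}$, $$f_{i,j}(x)=2^{\frac{i-1}{2}}f_{\mathrm{Haar}}\big(2^i(x-x_{i,j})\big),\qquad x_{i,j}=(2j+1)/2^i .$$ For $\ell=(\ell_1,\ldots,\ell_d)\in\mathbb{N}_0^d$ and $\mathbf{j}=(j_1,\ldots,j_d)$ with each $j_i$ an admissible index for level $\ell_i$, put $\varphi_{\ell,\mathbf{j}}(x)=\prod_{i=1}^d f_{\ell_i,j_i}(x_i)$ for $x\in[0,1]^d$. Let $W_\ell$ be the span of all $\varphi_{\ell,\mathbf{j}}$ of level $\ell$. These functions are orthonormal in $L^2([0,1]^d)$, so $\dim W_\ell=\prod_{i=1}^d 2^{\max\{0,\ell_i-1\}}=2^{\sum_{\ell_i\ne 0}(\ell_i-1)}$. For $N\in\mathbb{N}_0$ let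 $\mathbf{I}(N)=\{\ell\in\mathbb{N}_0^d : |\ell|\le N\}$, where $|\ell|=\ell_1+\cdots+\ell_d$, and $W_{\mathbf{I}(N)}=\bigoplus_{\ell\in\mathbf{I}(N)}W_\ell$. Thus $$C(N,d)=\dim W_{\mathbf{I}(N)}=\sum_{\ell\in\mathbb{N}_0^d,\ |\ell|\le N}2^{\sum_{\ell_i\ne0}(\ell_i-1)} .$$ The symbol $\doteq$ denotes equality of the leading order term in $N$ (with $d$ fixed). *)

(* Defs.v *)
From HB Require Import structures.
From mathcomp Require Import all_boot all_order all_algebra.
From mathcomp Require Import all_classical all_reals all_analysis.

Set Implicit Arguments.
Unset Strict Implicit.
Unset Printing Implicit Defensive.
Import Order.TTheory GRing.Theory Num.Theory.
Local Open Scope classical_set_scope.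
Local Open Scope ring_scope.

Section LinearAlgebra.
Variables (K : fieldType) (V : lmodType K).

Definition linear_span (A : set V) : set V :=
  [set v | exists (n : nat) (a : 'I_n -> K) (g : 'I_n -> V),
    (forall i, A (g i)) /\ v = \sum_(i < n) a i *: g i].

Definition linearly_independent (n : nat) (b : 'I_n -> V) : Prop :=
  forall a : 'I_n -> K, \sum_(i < n) a i *: b i = 0 -> forall i, a i = 0.

Definition is_basis (W : set V) (n : nat) (b : 'I_n -> V) : Prop :=
  linearly_independent b /\ linear_span (range b) = W.

(* The length of a basis of W. The default value 0 is returned when W has no
   finite basis. V itself may be infinite-dimensional, which is why vectType
   and its dimension are not used. *)
Definition dimension (W : set V) : nat :=
  xget 0%N [set n | exists b : 'I_n -> V, is_basis W b].

End LinearAlgebra.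

Unset Implicit Arguments.

Section Haar.
Variable R : realType.

Definition f_Haar (x : R) : R := if `|x| <= 1 then - Num.sg x else 0.

Definition haar_center (i j : nat) : R := (2 * j + 1)%:R / 2 ^+ i.

Definition haar (i j : nat) (x : R) : R :=
  if i == 0%N then 1
  else 2 `^ ((i%:R - 1) / 2) * f_Haar (2 ^+ i * (x - haar_center i j)).

Definition haar_index (i j : nat) : bool :=
  if i == 0%N then j == 0%N else (j < 2 ^ (i - 1))%N.

Definition unit_cube (d : nat) : set 'rV[R]_d :=
  [set x | forall i, 0 <= x ord0 i <= 1].

Definition haar_tensor (d : nat) (l j : {ffun 'I_d -> nat})
    (x : unit_cube d) : R :=
  \prod_(i < d) haar (l i) (j i) (\val x ord0 i).

Definition W_level (d : nat) (l : {ffun 'I_d -> nat}) :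
    set (unit_cube d -> R) :=
  linear_span [set haar_tensor d l j | j in
    [set j : {ffun 'I_d -> nat} | forall i, haar_index (l i) (j i)]].

Definition sparse_levels (d N : nat) : set {ffun 'I_d -> nat} :=
  [set l | (\sum_(i < d) l i <= N)%N].

(* The sum of a family of subspaces is the span of their union. *)
Definition W_sparse (d N : nat) : set (unit_cube d -> R) :=
  linear_span (\bigcup_(l in sparse_levels d N) W_level d l).

Definition C_sparse (N d : nat) : nat := dimension (W_sparse d N).

End Haar.

(* Main.v *)
Require Import Defs.
From mathcomp Require Import all_boot all_order all_algebra.
From mathcomp Require Import all_classical all_reals all_analysis.
From mathcomp Require Import zify ring lra.
Import Order.TTheory GRing.Theory Num.Theory.
Import numFieldNormedType.Exports.
Local Open Scope classical_set_scope.
Local Open Scope ring_scope.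

(** C(N, d) is a number of Haar tensors, and that number has a closed form.

    The tensors of level at most N span the space by definition, so its
    dimension is their number once they are linearly independent.  They are
    bare functions on the cube, not classes modulo null sets, so independence
    is obtained by point evaluations: to an index (i, j) corresponds the
    functional [jump i j], which subtracts the value of a function at the
    centre of the right half of the support of the Haar function (i, j) from
    its value at the centre of the left half; for i = 0, it is the value at a
    point.  It kills every Haar function of level at most i except (i, j)
    itself, because such a function is constant inside the support of (i, j).
    Tensor products of these functionals are therefore triangular with respect
    to the total level, with nonzero diagonal ([haar_tensors_independent]).

    The number of pairs (l, j) with |l| <= N is read off a generating
    function: it is the coefficient of X^N in P^d (1 + X + ... + X^N), where P
    is the sum of the m_i X^i over i <= N, and m_0 = 1, m_i = 2^(i-1) are the
    numbers of Haar functions of level i ([card_sparse_index]).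
    As 2 m_i = [i = 0] + 2^i, multiplication by 2 P sends the sequence
    u_j(k) = 2^k 'C(k + j, j) to u_j + u_{j+1}: the first summand of 2 m_i
    reproduces u_j, and the second one gives u_{j+1} by the hockey-stick
    identity.  Since C(., 1) = u_0, iterating yields, by Pascal's rule,

      2^e C(N, e + 1) = 2^N \sum_(j <= e) 'C(e, j) 'C(N + j, j)

    ([C_sparse_closed_form]).  As 'C(N + j, j) / N^j tends to 1 / j!, after
    division by N^e only the summand j = e survives in the limit, and it
    contributes 1 / e!. *)

(** * Spans, dimension and a triangular criterion for independence *)

Section Span.
Context {K : fieldType} {V : lmodType K}.
Implicit Types (A B : set V).

(** The two linear combinations are concatenated along 'I_n + 'I_m. *)
Lemma linear_span_comb A (c : K) (u v : V) :
  linear_span A u -> linear_span A v -> linear_span A (c *: u + v).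
Proof.
move=> [n [a [g [gA ->]]]] [m [a' [g' [g'A ->]]]].
exists (n + m)%N,
  (fun k => match fintype.split k with inl i => c * a i | inr j => a' j end),
  (fun k => match fintype.split k with inl i => g i | inr j => g' j end).
split=> [k|]; first by case: (fintype.split k).
rewrite big_split_ord /= scaler_sumr; congr (_ + _); apply: eq_bigr => i _.
  by rewrite (unsplitK (inl i)) scalerA.
by rewrite (unsplitK (inr i)).
Qed.

Lemma sub_linear_span A : A `<=` linear_span A.
Proof.
move=> v Av; exists 1%N, (fun=> 1), (fun=> v); split=> //.
by rewrite big_ord1 scale1r.
Qed.

Lemma linear_span0 A : linear_span A 0.
Proof.
by exists 0%N, (fun=> 0), (fun=> 0); split=> [[]//|]; rewrite big_ord0.
Qed.

Lemma linear_span_min A B : A `<=` linear_span B ->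
  linear_span A `<=` linear_span B.
Proof.
move=> AB v [n [a [g [gA ->]]]].
elim/big_ind: _ => [|x y|i _]; first exact: linear_span0.
  by move=> Bx By; rewrite -[x]scale1r; exact: linear_span_comb.
rewrite -[_ *: _]addr0.
by apply: linear_span_comb; [exact/AB/gA|exact: linear_span0].
Qed.

Lemma linear_span_bigcup (I : Type) (P : set I) (F : I -> set V) :
  linear_span (\bigcup_(i in P) linear_span (F i)) =
  linear_span (\bigcup_(i in P) F i).
Proof.
apply/seteqP; split; apply: linear_span_min => v [i Pi Fv].
  apply: (@linear_span_min (F i)) Fv => w Fw.
  by apply: sub_linear_span; exists i.
by apply: sub_linear_span; exists i => //; exact: sub_linear_span.
Qed.

Lemma linear_span_rangeP {n} {b : 'I_n -> V} {v} : linear_span (range b) v ->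
  exists a : 'I_n -> K, v = \sum_i a i *: b i.
Proof.
move=> [m [a [g [gA ->]]]].
elim/big_ind: _ => [|_ _ [x ->] [y ->]|i _].
- by exists (fun=> 0); rewrite big1 // => i _; rewrite scale0r.
- exists (fun i => x i + y i); rewrite -big_split /=.
  by apply: eq_bigr => i _; rewrite scalerDl.
- have [k _ <-] := gA i.
  exists (fun k' => if k' == k then a i else 0).
  rewrite (bigD1 k) //= eqxx big1 ?addr0 // => k' /negbTE ->.
  by rewrite scale0r.
Qed.

(** If n > m, the n x m matrix that expresses b in terms of c has a nonzero row
    in its left kernel, and that row is a linear relation between the b i. *)
Lemma leq_independent_span {m n} (b : 'I_n -> V) (c : 'I_m -> V) :
  linearly_independent b -> range b `<=` linear_span (range c) -> (n <= m)%N.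
Proof.
move=> indb bc; rewrite leqNgt; apply/negP => mn.
have /choice[A bA] i : exists a : 'I_m -> K, b i = \sum_j a j *: c j.
  by apply: linear_span_rangeP; apply: bc; exists i.
pose M := \matrix_(i < n, j < m) A i j.
have : kermx M != 0.
  rewrite -mxrank_eq0 mxrank_ker subn_eq0 -ltnNge.
  exact: leq_ltn_trans (rank_leq_col M) mn.
move=> /matrix0Pn[r [s]]; apply/negP; rewrite negbK; apply/eqP.
apply: (indb (fun i => kermx M r i)) => {s}.
under eq_bigr do rewrite bA scaler_sumr.
rewrite exchange_big big1 //= => j _.
under eq_bigr do rewrite scalerA.
rewrite -scaler_suml.
have : (kermx M *m M) r j = 0 by rewrite mulmx_ker mxE.
rewrite mxE; under eq_bigr do rewrite [M _ _]mxE.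
by move=> ->; rewrite scale0r.
Qed.

Lemma dimension_basis {n} (W : set V) (b : 'I_n -> V) :
  is_basis W b -> dimension W = n.
Proof.
move=> [indb spanb]; rewrite /dimension; case: xgetP => [m _|]; last first.
  by move=> /(_ n); case; exists b.
move=> [c [indc spanc]].
apply/eqP; rewrite eqn_leq; apply/andP; split.
  by apply: (leq_independent_span c b) => //; rewrite spanb -spanc;
     exact: sub_linear_span.
by apply: (leq_independent_span b c) => //; rewrite spanc -spanb;
   exact: sub_linear_span.
Qed.

(** In a linear relation, the functional attached to a term of maximal rank
    among those with a nonzero coefficient isolates that coefficient. *)
Lemma triangular_independent {n} (b : 'I_n -> V) (r : 'I_n -> nat)
    (L : 'I_n -> V -> K) :
  (forall k m (a : 'I_m -> K) v,
     L k (\sum_i a i *: v i) = \sum_i a i * L k (v i)) ->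
  (forall k, L k (b k) != 0) ->
  (forall k m, L k (b m) != 0 -> m = k \/ (r k < r m)%N) ->
  linearly_independent b.
Proof.
move=> linL diagL triL a ab0 i0; apply: contrapT => /eqP ai0.
have [k ak kmax] := @arg_maxnP _ i0 (fun i => a i != 0) r ai0.
have : L k (\sum_i a i *: b i) = 0.
  by have := linL k 0%N (fun=> 0) (fun=> 0); rewrite !big_ord0 ab0.
rewrite linL (bigD1 k) //= big1 ?addr0 => [/eqP|m mk].
  by rewrite mulf_eq0 (negbTE ak) (negbTE (diagL k)).
apply/eqP; rewrite mulf_eq0; have [//|am /=] := eqVneq (a m) 0.
apply/negPn/negP => /triL[/eqP|]; first by rewrite (negbTE mk).
by have /= := kmax _ am; rewrite leqNgt => /negP.
Qed.

End Span.

(** * The generating function of the count *)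

Lemma hockey_stick n j :
  (\sum_(i < n.+1) 'C(i + j, j) = 'C(n + j.+1, j.+1))%N.
Proof.
elim: n => [|n IH]; first by rewrite big_ord1 !add0n !binn.
by rewrite big_ord_recr /= IH [in RHS]addSn binS addSnnS.
Qed.

Lemma pascal_sum (T : nmodType) d (b : nat -> T) :
  \sum_(j < d.+1) (b j + b j.+1) *+ 'C(d, j) =
  \sum_(j < d.+2) b j *+ 'C(d.+1, j).
Proof.
rewrite [RHS]big_ord_recl /= bin0.
under [X in _ = _ + X]eq_bigr do rewrite /bump /= add1n binS mulrnDr.
under eq_bigr do rewrite mulrnDl.
rewrite !big_split /= addrA; congr (_ + _).
rewrite [in RHS]big_ord_recr /= bin_small // mulr0n addr0.
by rewrite big_ord_recl /= bin0.
Qed.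

(** The number of Haar functions of level i. *)
Definition level_dim (i : nat) : nat :=
  if i == 0%N then 1%N else (2 ^ (i - 1))%N.

Definition level_poly (K : fieldType) (N : nat) : {poly K} :=
  \poly_(i < N.+1) (level_dim i)%:R.

(** Multiplication by 2 P, where P is the level polynomial, replaces a
    coefficient sequence u by u plus its convolution with the powers of 2; on
    the sequence 2^k 'C(k + j, j), that convolution raises j by one.  The
    truncation of P at degree N does not affect the coefficients up to N.
    Multiplication by 1 + ... + X^N turns coefficients into partial sums. *)
Lemma coef_level_poly_exp (K : fieldType) (N d k : nat) :
  (2 : K) != 0 -> (k <= N)%N ->
  2 ^+ d * (level_poly K N ^+ d.+1 * \poly_(i < N.+1) 1)`_k =
  2 ^+ k * \sum_(j < d.+1) ('C(k + j, j))%:R *+ 'C(d, j).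
Proof.
move=> K2; set P := level_poly K N; set G := \poly_(i < N.+1) 1.
have P2 i : (i <= N)%N -> 2 * P`_i = (i == 0%N)%:R + 2 ^+ i.
  move=> iN; rewrite coef_poly ltnS iN /level_dim; case: i iN => [|i] _ /=.
    by rewrite expr0 mulr1.
  by rewrite subn1 add0r exprS natrX.
have step (u : {poly K}) (m : nat) : (m <= N)%N ->
    2 * (P * u)`_m = u`_m + \sum_(i < m.+1) 2 ^+ (m - i) * u`_i.
  move=> mN; rewrite coefM mulr_sumr.
  under eq_bigr => i _ do
    rewrite mulrA (P2 _ (leq_trans (leq_ord i) mN)) mulrDl.
  rewrite big_split /=; congr (_ + _).
    rewrite big_ord_recl /= mul1r subn0 big1 ?addr0 // => i _.
    by rewrite mul0r.
  rewrite (reindex_inj rev_ord_inj) /=; apply: eq_bigr => i _.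
  by rewrite subSS subKn // leq_ord.
elim: d k => [|d IH] k kN.
  rewrite expr0 expr1 mul1r big_ord1 addn0 bin0 bin0 mulr1n mulr1.
  apply: (mulfI K2); rewrite step // coef_poly ltnS kN.
  under eq_bigr => i _ do
    rewrite coef_poly ltnS (leq_trans (leq_ord i) kN) mulr1.
  elim: k kN => [|k IHk] kN; first by rewrite big_ord1 subnn expr0; ring.
  by rewrite big_ord_recl subn0 addrCA (IHk (ltnW kN)) exprS; ring.
rewrite exprS -mulrA mulrCA [P ^+ _]exprS -mulrA step // mulrDr IH //.
rewrite -(pascal_sum _ _ (fun j => ('C(k + j, j))%:R)).
under [X in _ = _ * X]eq_bigr do rewrite mulrnDl.
rewrite big_split /= mulrDr; congr (_ + _).
transitivity (\sum_(i < k.+1) 2 ^+ k *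
    \sum_(j < d.+1) ('C(i + j, j))%:R *+ 'C(d, j) : K).
  rewrite mulr_sumr; apply: eq_bigr => i _.
  rewrite mulrCA (IH _ (leq_trans (leq_ord i) kN)) mulrA -exprD.
  by rewrite (subnK (leq_ord i)).
rewrite -mulr_sumr exchange_big /=; congr (_ * _); apply: eq_bigr => j _.
by rewrite sumrMnl -natr_sum hockey_stick.
Qed.

(** * Asymptotics of the closed form *)

Section Lim.
Context (R : realType).

(** Passing from j to j + 1 multiplies the ratio by (1 + (j + 1) / N) / (j + 1).
    Here and below N is shifted by one, so that it is never zero. *)
Lemma cvg_binomial_ratio j :
  (fun N : nat => ('C(N.+1 + j, j))%:R / N.+1%:R ^+ j : R) @ \oo -->
  (j`!%:R^-1 : R).
Proof.
elim: j => [|j IH].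
  under eq_fun do rewrite bin0 expr0 divr1.
  by rewrite fact0 invr1; exact: cvg_cst.
have -> : (fun N : nat => ('C(N.+1 + j.+1, j.+1))%:R / N.+1%:R ^+ j.+1 : R) =
  (fun N : nat => ('C(N.+1 + j, j)%:R / N.+1%:R ^+ j) *
     ((1 + j.+1%:R * harmonic N) * j.+1%:R^-1)).
  apply/funext => N.
  have binE : j.+1%:R * 'C(N.+1 + j.+1, j.+1)%:R =
      (N.+1 + j.+1)%:R * 'C(N.+1 + j, j)%:R :> R.
    by rewrite -!natrM -mul_bin_diag addnS.
  have j0 : j.+1%:R != 0 :> R by rewrite pnatr_eq0.
  have N0 : N.+1%:R != 0 :> R by rewrite pnatr_eq0.
  apply: (mulfI j0); rewrite mulrA binE /= exprSr natrD.
  move: N.+1%:R j.+1%:R N0 j0 => x y x0 y0.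
  by field; rewrite x0 y0 expf_neq0.
have -> : (j.+1`!)%:R^-1 = j`!%:R^-1 * ((1 + j.+1%:R * 0) * j.+1%:R^-1) :> R.
  by rewrite factS natrM invfM mulr0 addr0 mul1r mulrC.
apply: cvgM IH _; apply: cvgM; last exact: cvg_cst.
apply: cvgD; first exact: cvg_cst.
by apply: cvgM; [exact: cvg_cst|exact: cvg_harmonic].
Qed.

(** After division by N^e the j-th summand is a convergent ratio times
    N^(j - e), which vanishes in the limit unless j = e. *)
Lemma cvg_binomial_sum e :
  (fun N : nat => e`!%:R * (\sum_(j < e.+1) ('C(N.+1 + j, j))%:R *+ 'C(e, j))
     / N.+1%:R ^+ e : R) @ \oo --> (1 : R).
Proof.
have -> : (fun N : nat => e`!%:R *
    (\sum_(j < e.+1) ('C(N.+1 + j, j))%:R *+ 'C(e, j)) / N.+1%:R ^+ e : R) =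
  (fun N => \sum_(j < e.+1) (e`!%:R * 'C(e, j)%:R) *
    (('C(N.+1 + j, j)%:R / N.+1%:R ^+ j) * harmonic N ^+ (e - j))).
  apply/funext => N; rewrite mulr_sumr mulr_suml; apply: eq_bigr => j _.
  have N0 : N.+1%:R != 0 :> R by rewrite pnatr_eq0.
  have -> : N.+1%:R ^+ e = N.+1%:R ^+ (e - j) * N.+1%:R ^+ j :> R.
    by rewrite -exprD (subnK (leq_ord j)).
  rewrite -mulr_natr /harmonic /= exprVn.
  move: N.+1%:R N0 => x x0.
  by field; rewrite !expf_neq0.
set u := (fun N : nat => \sum_(j < e.+1) _).
have <- : \sum_(j < e.+1) (e`!%:R * 'C(e, j)%:R) *
    (j`!%:R^-1 * 0 ^+ (e - j)) = 1 :> R.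
  rewrite big_ord_recr /= big1 ?add0r => [|j _].
    by rewrite subnn expr0 binn !mulr1 divff // pnatr_eq0 -lt0n fact_gt0.
  by rewrite expr0n subn_eq0 leqNgt ltn_ord !mulr0.
rewrite /u; apply: cvg_big => [|j _]; first exact: add_continuous.
apply: cvgM; first exact: cvg_cst.
apply: cvgM; first exact: cvg_binomial_ratio.
exact: (cvg_comp _ _ (@cvg_harmonic R) (@exprn_continuous R (e - j) 0)).
Qed.

End Lim.

(** * One-dimensional jump functionals *)

Section Jump.
Context (R : realType).

Lemma f_Haar_lt0 (x : R) : -1 <= x < 0 -> f_Haar R x = 1.
Proof.
move=> /andP[x1 x0]; rewrite /f_Haar ler_norml x1 (le_trans (ltW x0)) //.
by rewrite ltr0_sg // opprK.
Qed.

Lemma f_Haar_gt0 (x : R) : 0 < x <= 1 -> f_Haar R x = -1.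
Proof.
move=> /andP[x0 x1].
rewrite /f_Haar ler_norml x1 (le_trans _ (ltW x0)) ?lerN10 //.
by rewrite gtr0_sg.
Qed.

Lemma f_Haar_out (x : R) : 1 < `|x| -> f_Haar R x = 0.
Proof. by rewrite /f_Haar ltNge => /negbTE ->. Qed.

(** The two arguments are the midpoints of the two intervals of length 1 / b
    that meet at a / b.  [f_Haar] is constant on the union of their interiors
    unless a / b is one of its discontinuities -1, 0, 1. *)
Lemma f_Haar_step (a b : int) : 0 < b -> a != 0 -> a != b -> a != - b ->
  f_Haar R ((2 * a - 1)%:~R / (2 * b)%:~R) =
  f_Haar R ((2 * a + 1)%:~R / (2 * b)%:~R).
Proof.
move=> b0 a0 ab aNb.
have b2 : (0 : R) < (2 * b)%:~R by rewrite ltr0z; lia.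
have bN : (- (2 * b))%:~R = - (2 * b)%:~R :> R by rewrite rmorphN.
have : [|| a < - b, (- b < a) && (a < 0), (0 < a) && (a < b) | b < a] by lia.
case/or4P => [h|/andP[h1 h2]|/andP[h1 h2]|h].
- rewrite !f_Haar_out // lter_normr; apply/orP; right;
    by rewrite -mulNr ltr_pdivlMr // mul1r -rmorphN ltr_int; lia.
- rewrite !f_Haar_lt0 //; apply/andP; split;
    by rewrite ?ler_pdivlMr ?ltr_pdivrMr // ?mulN1r ?mul0r -?bN ?ltrz0
      ?ler_int; lia.
- rewrite !f_Haar_gt0 //; apply/andP; split;
    by rewrite ?ler_pdivrMr ?ltr_pdivlMr // ?mul1r ?mul0r ?ltr0z ?ler_int; lia.
- rewrite !f_Haar_out // lter_normr; apply/orP; left;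
    by rewrite ltr_pdivlMr // mul1r ltr_int; lia.
Qed.

(** The centre of the left or right half of the support of the Haar function
    (i, j).  At level 0, where the function is constant, any point will do. *)
Definition half_center (i j : nat) (left : bool) : R :=
  if i == 0%N then 0
  else (if left then 4 * j + 1 else 4 * j + 3)%:R / 2 ^+ i.+1.

Definition half_weight (i : nat) (left : bool) : R :=
  if left then 1 else if i == 0%N then 0 else -1.

Definition jump (i j : nat) (f : R -> R) : R :=
  \sum_(s : bool) half_weight i s * f (half_center i j s).

Lemma jumpE i j f : (0 < i)%N ->
  jump i j f = f (half_center i j true) - f (half_center i j false).
Proof.
rewrite lt0n => /negbTE i0.
by rewrite /jump big_bool /half_weight i0 mul1r mulN1r.
Qed.

Lemma half_center_itv i j s : haar_index i j -> 0 <= half_center i j s <= 1.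
Proof.
rewrite /haar_index /half_center; case: i => [_|i] /=.
  by rewrite lexx ler01.
rewrite subn1 /= => ji; have e0 : (0 : R) < 2 ^+ i.+2 by rewrite exprn_gt0.
apply/andP; split; first by rewrite divr_ge0 // ltW.
rewrite ler_pdivrMr // mul1r -natrX ler_nat !expnS.
by case: s; lia.
Qed.

(** With i the level of the Haar function and k + i that of the sampled index,
    rescaling by 2^i turns the difference of the two centres into a / 2^k and
    the distance from a centre to that of a half into 1 / (2 2^k). *)
Lemma haar_half_center k i j j' (s : bool) : (0 < i)%N ->
  let a : int := (2 * j + 1)%:Z - (2 ^ k * (2 * j' + 1))%:Z in
  haar R i j' (half_center (k + i) j s) = 2 `^ ((i%:R - 1) / 2) *
    f_Haar R ((if s then 2 * a - 1 else 2 * a + 1)%:~R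
              / (2 * (2 ^ k)%N%:Z)%:~R).
Proof.
move=> i0 a; rewrite /haar /half_center addn_eq0 andbC !(gtn_eqF i0) /=.
congr (_ * f_Haar R _); rewrite /haar_center.
have k2 : (2 : R) ^+ k != 0 by rewrite expf_neq0.
have i2 : (2 : R) ^+ i != 0 by rewrite expf_neq0.
have -> : (2 * (2 ^ k)%N%:Z)%:~R = 2 * 2 ^+ k :> R.
  by rewrite intrM -pmulrn natrX.
have aE : a%:~R = 2 * j%:R + 1 - 2 ^+ k * (2 * j'%:R + 1) :> R.
  by rewrite intrB -!pmulrn !(natrD, natrM, natrX).
rewrite exprS exprD natrD natrM.
by case: s; rewrite ?(intrB, intrD) intrM aE natrD natrM; field; rewrite k2 i2.
Qed.

Lemma jump_haar_diag i j : haar_index i j -> jump i j (haar R i j) != 0.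
Proof.
case: i => [_|i _].
  by rewrite /jump big_bool /haar /half_weight /= mul0r addr0 mulr1 oner_neq0.
rewrite jumpE // -[in half_center _ _ true](add0n i.+1)
  -[in half_center _ _ false](add0n i.+1) !haar_half_center //=.
rewrite expn0 !mul1n subrr mulr0 !add0r.
rewrite f_Haar_lt0 ?f_Haar_gt0; last 2 first.
- by apply/andP; split; lra.
- by apply/andP; split; lra.
rewrite -mulrBr mulf_neq0 ?gt_eqF ?powR_gt0 //; lra.
Qed.

(** With k = i - i', the number a of [haar_half_center] has the parity of
    1 + 2^k, so a / 2^k is never 1 or -1, and it is 0 only if k = 0 and
    j = j'.  In all other cases [f_Haar_step] makes the jump vanish. *)
Lemma jump_haar_triangular i j i' j' : haar_index i j -> haar_index i' j' ->
  jump i j (haar R i' j') != 0 -> (i', j') = (i, j) \/ (i < i')%N.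
Proof.
move=> ij ij' J0; have [?|i'i] := ltnP i i'; [by right|left].
move: J0; have [i0|i0] := posnP i.
  by move: i'i ij ij'; rewrite i0 leqn0 /haar_index => /eqP -> /eqP -> /eqP ->.
have [i'0|i'0] := posnP i'.
  by rewrite i'0 jumpE // /haar /= subrr eqxx.
apply: contra_neqP => neq.
rewrite jumpE // -(subnK i'i) !haar_half_center //=.
rewrite f_Haar_step ?subrr //.
- by rewrite ltz_nat expn_gt0.
all: move: neq; move: i'i; rewrite leq_eqVlt => /predU1P[->|ii'] neq.
all: rewrite ?subnn ?expn0 ?mul1n; try lia.
- by apply/eqP => e; apply: neq; congr (_, _); lia.
all: rewrite -(subnSK ii') expnS; lia.
Qed.

End Jump.

(** * Counting the Haar tensors *)

(** An index of a Haar tensor of level at most N: each coordinate carries a pair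
    (level, shift).  The bounds N + 1 and 2^N are large enough for all these
    indices and make their type finite. *)
Definition sparse_index (d N : nat) :
    pred {ffun 'I_d -> 'I_N.+1 * 'I_(2 ^ N)} :=
  fun t => (\sum_i (t i).1 <= N)%N && [forall i, haar_index (t i).1 (t i).2].

Lemma card_haar_index n i : (i <= n)%N ->
  (\sum_(j < 2 ^ n) haar_index i j = level_dim i)%N.
Proof.
move=> iN.
transitivity (\sum_(j < 2 ^ n | (j < level_dim i)%N) 1)%N.
  rewrite [RHS]big_mkcond; apply: eq_bigr => j _ /=.
  by rewrite /haar_index /level_dim; case: i iN => [|i] _ /=;
    rewrite ?ltnS ?leqn0; case: ifP.
have le2 : (level_dim i <= 2 ^ n)%N.
  rewrite /level_dim; case: ifP => _; first by rewrite expn_gt0.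
  by rewrite leq_exp2l // (leq_trans (leq_subr _ _)).
by rewrite (big_ord_narrow le2) sum1_card card_ord.
Qed.

(** Expanding P^d by distributivity gives one monomial per family of pairs
    (level, shift), with exponent the total level; the monomial X^a
    contributes to the coefficient of X^N in P^d (1 + ... + X^N) exactly when
    a <= N. *)
Lemma card_sparse_index (K : fieldType) (d N : nat) :
  #|sparse_index d N|%:R =
  (level_poly K N ^+ d * \poly_(i < N.+1) 1)`_N :> K.
Proof.
have -> : level_poly K N = \sum_(p : 'I_N.+1 * 'I_(2 ^ N))
    (haar_index p.1 p.2)%:R *: 'X^(p.1) :> {poly K}.
  rewrite /level_poly poly_def -(pair_bigA _
    (fun (i : 'I_N.+1) (j : 'I_(2 ^ N)) =>
      (haar_index i j)%:R *: 'X^i : {poly K})) /=.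
  apply: eq_bigr => i _; rewrite -scaler_suml -natr_sum.
  by rewrite (card_haar_index _ _ (leq_ord i)).
rewrite -[X in _ ^+ X](card_ord d) -prodr_const bigA_distr_bigA /=.
rewrite mulr_suml coef_sum -sum1_card natr_sum big_mkcond /=.
apply: eq_bigr => t _.
rewrite scaler_prod -scalerAl coefZ prodrXr coefXnM coef_poly.
rewrite ltnS leq_subr unfold_in /sparse_index ltnNge.
case: leqP => _ /=; last by rewrite mulr0.
case: forallP => [all|nall].
  by rewrite big1 ?mulr1 // => i _; rewrite all.
have /existsP[i ni] : [exists i, ~~ haar_index (t i).1 (t i).2].
  by rewrite -negb_forall; apply/forallP.
by rewrite (bigD1 i) //= (negbTE ni) !mul0r.
Qed.

(** * The basis of Haar tensors *)

Section Tensor.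
Context (R : realType) (d : nat).

(** The tensor product of the functionals [jump (l i) (j i)]: a signed sum over
    the 2^d choices of a half in each coordinate.  On a product function it
    factors, by distributivity. *)
Lemma tensor_jump (l j : {ffun 'I_d -> nat}) :
  (forall i, haar_index (l i) (j i)) ->
  exists L : (unit_cube R d -> R) -> R,
    (forall m (a : 'I_m -> R) v,
       L (\sum_i a i *: v i) = \sum_i a i * L (v i)) /\
    (forall l' j', L (haar_tensor R d l' j') =
       \prod_i jump R (l i) (j i) (haar R (l' i) (j' i))).
Proof.
move=> lj.
have /choice[p pE] (s : {ffun 'I_d -> bool}) : exists x : unit_cube R d,
    forall i, \val x ord0 i = half_center R (l i) (j i) (s i).
  have xP : unit_cube R d (\row_i half_center R (l i) (j i) (s i)).
    by move=> i; rewrite mxE; exact: half_center_itv.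
  by exists (SigSub (mem_set xP)) => i; rewrite mxE.
exists (fun f => \sum_(s : {ffun 'I_d -> bool})
  (\prod_i half_weight R (l i) (s i)) * f (p s)); split=> [m a v|l' j'].
  under eq_bigr do rewrite fct_sumE mulr_sumr.
  rewrite exchange_big; apply: eq_bigr => i _.
  by rewrite mulr_sumr; apply: eq_bigr => s _; rewrite mulrCA.
rewrite /jump bigA_distr_bigA; apply: eq_bigr => s _.
by rewrite -big_split; apply: eq_bigr => i _; rewrite pE.
Qed.

Context (N : nat).
Local Notation T := {ffun 'I_d -> 'I_N.+1 * 'I_(2 ^ N)}.

Definition level (t : T) : {ffun 'I_d -> nat} := [ffun i => nat_of_ord (t i).1].
Definition shift (t : T) : {ffun 'I_d -> nat} := [ffun i => nat_of_ord (t i).2].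
Definition sparse_tensor (k : 'I_#|sparse_index d N|) : unit_cube R d -> R :=
  haar_tensor R d (level (enum_val k)) (shift (enum_val k)).

(** If the functional of index k does not vanish on the tensor of index m, then
    in each coordinate either the two indices agree or the level strictly
    increases from k to m; hence k = m or the total level increases. *)
Lemma haar_tensors_independent : linearly_independent sparse_tensor.
Proof.
have adm (k : 'I_#|sparse_index d N|) i :
    haar_index (level (enum_val k) i) (shift (enum_val k) i).
  by have /andP[_ /forallP] := enum_valP k; move=> /(_ i); rewrite !ffunE.
have /choice[L LP] (k : 'I_#|sparse_index d N|) := tensor_jump _ _ (adm k).
apply: (@triangular_independent _ _ _ sparse_tensor
  (fun k => \sum_i level (enum_val k) i)%N L) => [k|k|k m].
- by have [] := LP k.
- have [_ ->] := LP k; apply/prodf_neq0 => i _.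
  exact/jump_haar_diag/adm.
- have [_ ->] := LP k; move=> /prodf_neq0 J0.
  have tri i := jump_haar_triangular _ _ _ _ _ (adm k i) (adm m i) (J0 i isT).
  have lekm i : (level (enum_val k) i <= level (enum_val m) i)%N.
    by have [[-> _]//|/ltnW] := tri i.
  have [eqt|] := eqVneq (enum_val m) (enum_val k).
    by left; exact: enum_val_inj.
  move=> neq; right.
  have [i lti] : exists i, (level (enum_val k) i < level (enum_val m) i)%N.
    apply: contrapT => /forallNP nlt; move/eqP: neq; apply; apply/ffunP => i.
    have [|/nlt//] := tri i; rewrite !ffunE => -[e1 e2].
    rewrite [LHS]surjective_pairing [RHS]surjective_pairing.
    by congr (_, _); exact: val_inj.
  by rewrite (bigD1 i) //= [ltnRHS](bigD1 i) //= -addSn leq_add // leq_sum.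
Qed.

Lemma span_haar_tensors : linear_span (range sparse_tensor) = W_sparse R d N.
Proof.
rewrite /W_sparse /W_level linear_span_bigcup; congr linear_span.
apply/seteqP; split=> [_ [k _ <-]|_ [l lN [j lj <-]]].
  have /andP[kN /forallP adm] := enum_valP k.
  exists (level (enum_val k)).
    by rewrite /sparse_levels /=; under eq_bigr do rewrite ffunE.
  by exists (shift (enum_val k)) => // i; rewrite !ffunE.
have lN1 i : (l i < N.+1)%N.
  by rewrite ltnS (leq_trans _ lN) // (bigD1 i) //= leq_addr.
have jN i : (j i < 2 ^ N)%N.
  have := lj i; rewrite /haar_index; case: ifP => [_ /eqP ->|_ ji].
    by rewrite expn_gt0.
  by rewrite (leq_trans ji) // leq_exp2l // (leq_trans (leq_subr _ _)) // -ltnS.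
pose t : T := [ffun i => (Ordinal (lN1 i), Ordinal (jN i))].
have lt : level t = l by apply/ffunP => i; rewrite !ffunE.
have jt : shift t = j by apply/ffunP => i; rewrite !ffunE.
have tP : t \in sparse_index d N.
  apply/andP; split; last by apply/forallP => i; rewrite ffunE; exact: lj.
  by under eq_bigr do rewrite ffunE.
by exists (enum_rank_in tP t); rewrite // /sparse_tensor enum_rankK_in // lt jt.
Qed.

Lemma C_sparseE : C_sparse R N d = #|sparse_index d N|.
Proof.
apply: (dimension_basis _ sparse_tensor).
by split; [exact: haar_tensors_independent|exact: span_haar_tensors].
Qed.

End Tensor.

Lemma C_sparse_closed_form (R : realType) (N e : nat) :
  2 ^+ e * (C_sparse R N e.+1)%:R =
  2 ^+ N * \sum_(j < e.+1) ('C(N + j, j))%:R *+ 'C(e, j) :> R.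
Proof.
rewrite C_sparseE card_sparse_index.
by apply: coef_level_poly_exp; rewrite ?pnatr_eq0.
Qed.

Theorem lemma4p1 (R : realType) (d : nat) (hd : (1 <= d)%N) :
  (fun N : nat => ((C_sparse R N d)%:R * ((d - 1)`!)%:R)
     / (N%:R ^+ (d - 1) * (2 : R) ^ (N%:Z - d%:Z + 1)) : R)
    @ \oo --> (1 : R).
Proof.
case: d hd => // e _; rewrite subn1 /= -cvg_shiftS /=.
apply: cvg_trans (cvg_binomial_sum R e).
apply: near_eq_cvg; apply: nearW => N.
have e2 : (2 : R) ^+ e != 0 by rewrite expf_neq0.
have N2 : (2 : R) ^+ N.+1 != 0 by rewrite expf_neq0.
have N0 : N.+1%:R ^+ e != 0 :> R by rewrite expf_neq0 // pnatr_eq0.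
have -> : N.+1%:Z - e.+1%:Z + 1 = N.+1%:Z - e%:Z by lia.
rewrite expfzDr ?pnatr_eq0 // -exprnN -exprnP.
have -> : \sum_(j < e.+1) ('C(N.+1 + j, j))%:R *+ 'C(e, j) =
    2 ^+ e * (C_sparse R N.+1 e.+1)%:R / 2 ^+ N.+1 :> R.
  by rewrite C_sparse_closed_form mulrAC divff // mul1r.
by field; rewrite ?N0 ?e2 ?N2.
Qed.
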